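(* Let $\mathcal{Q}\subset\mathbb{R}^n$ be compact and let $(\mathcal{E},\mathcal{D})$ be a compression code for $\mathcal{Q}$ operating at rate $r$ and distortion $\delta$, with codebook $\mathcal{C}$. Let $A\in\mathbb{R}^{d\times n}$ have i.i.d. $\mathcal{N}(0,1)$ entries. For ${\bf x}_o\in\mathcal{Q}$, let $\hat{{\bf x}}_o$ be the CSP reconstruction from ${\bf y}_o=A{\bf x}_o$, i.e. any $\hat{{\bf x}}_o\in\arg\min_{{\bf c}\in\mathcal{C}}\|{\bf y}_o-A{\bf c}\|_2^2$. Then for arbitrary $\tau_1>0$ and $\tau_2\in(0,1)$, \[ \|\hat{{\bf x}}_o-{\bf x}_o\|_2\le\delta\sqrt{\frac{1+\tau_1}{1-\tau_2}} \] with probability at least \[ 1-2^{r}{\rm e}^{\frac d2(\tau_2+\log(1-\tau_2))}-{\rm e}^{-\frac d2(\tau_1-\log(1+\tau_1))}. \]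
   Context: A compression code $(\mathcal{E},\mathcal{D})$ for $\mathcal{Q}$ at rate $r$ consists of an encoder $\mathcal{E}:\mathcal{Q}\to\{1,2,\dots,2^r\}$ and a decoder $\mathcal{D}:\{1,\dots,2^r\}\to\mathbb{R}^n$; its codebook is $\mathcal{C}=\{\mathcal{D}(\mathcal{E}({\bf x})):{\bf x}\in\mathcal{Q}\}$ (so $|\mathcal{C}|\le2^r$), and its distortion is $\delta=\sup_{{\bf x}\in\mathcal{Q}}\|{\bf x}-\mathcal{D}(\mathcal{E}({\bf x}))\|_2$. $\log$ denotes the natural logarithm. *)

(* Defs.v *)
From HB Require Import structures.
From mathcomp Require Import all_boot all_order all_algebra.
From mathcomp Require Import all_classical all_reals all_analysis.
Set Implicit Arguments. Unset Strict Implicit. Unset Printing Implicit Defensive.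
Import Order.TTheory GRing.Theory Num.Theory.
Import numFieldTopology.Exports numFieldNormedType.Exports.
Local Open Scope classical_set_scope.
Local Open Scope ring_scope.

Definition norm2 {R : realType} {n : nat} (x : 'cV[R]_n) : R :=
  Num.sqrt (\sum_(i < n) x i ord0 ^+ 2).

(* A compression code at rate r: encoder Q -> {1..2^r} (here 'I_(2^r)),
   decoder {1..2^r} -> R^n. *)
Definition codebook {R : realType} {n r : nat} (Q : set 'cV[R]_n)
  (E : 'cV[R]_n -> 'I_(2 ^ r)) (D : 'I_(2 ^ r) -> 'cV[R]_n) : set 'cV[R]_n :=
  [set D (E x) | x in Q].

Definition distortion {R : realType} {n r : nat} (Q : set 'cV[R]_n)
  (E : 'cV[R]_n -> 'I_(2 ^ r)) (D : 'I_(2 ^ r) -> 'cV[R]_n) : R :=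
  sup [set norm2 (x - D (E x)) | x in Q].

Definition mutually_independent {d : measure_display} {T : measurableType d}
  {R : realType} (P : probability T R) {I : finType} (X : I -> T -> R) : Prop :=
  forall B : I -> set R, (forall i, measurable (B i)) ->
    P (\bigcap_(i in [set: I]) (X i @^-1` B i)) = (\prod_(i : I) P (X i @^-1` B i))%E.

Definition std_normal_rv {d : measure_display} {T : measurableType d}
  {R : realType} (P : probability T R) (X : T -> R) : Prop :=
  measurable_fun setT X /\
  forall B : set R, measurable B -> P (X @^-1` B) = normal_prob 0 1 B.

Definition csp_minimizer {R : realType} {n d : nat} (C : set 'cV[R]_n)
  (A : 'M[R]_(d, n)) (y : 'cV[R]_d) (xhat : 'cV[R]_n) : Prop :=
  C xhat /\ forall c, C c -> norm2 (y - A *m xhat) ^+ 2 <= norm2 (y - A *m c) ^+ 2.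

(* Main.v *)
(** For a fixed vector v, [|A v|^2 / |v|^2] is chi-squared with [d] degrees of
    freedom; Chernoff's bound controls its upper tail for v = x_o - D(E(x_o))
    and, by a union bound, its lower tail for all the vectors v = x_o - c with
    c in the codebook.  Off these events,
      d (1 - tau2) |x_o - xhat|^2 <= |A (x_o - xhat)|^2
        <= |A (x_o - D(E(x_o)))|^2 <= d (1 + tau1) delta^2,
    the middle step being the minimality of xhat.

    The moment generating function is computed without identifying the law of
    [A v]: integrating out one standard Gaussian [x] at a time,
      E exp (mu (s + a x)^2) = (1 - 2 mu a^2)^(-1/2) exp (mu' s^2)
      with mu' = mu / (1 - 2 mu a^2),
    and these factors telescope along a row of [A] to
    [(1 - 2 mu |v|^2)^(-1/2)].  *)
Require Import Defs.
From HB Require Import structures.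
From mathcomp Require Import all_boot all_order all_algebra.
From mathcomp Require Import all_classical all_reals all_analysis.
From mathcomp Require Import measurable_realfun ring lra.
Set Implicit Arguments. Unset Strict Implicit. Unset Printing Implicit Defensive.
Import Order.TTheory GRing.Theory Num.Theory.
Import numFieldTopology.Exports numFieldNormedType.Exports.
Local Open Scope classical_set_scope.
Local Open Scope ring_scope.

(** * The Euclidean norm *)

Section norm2_theory.
Context {R : realType} {n : nat}.
Implicit Types x : 'cV[R]_n.

Lemma norm2_ge0 x : 0 <= norm2 x. Proof. exact: sqrtr_ge0. Qed.

Lemma sqr_norm2 x : norm2 x ^+ 2 = \sum_i x i ord0 ^+ 2.
Proof. by rewrite sqr_sqrtr// sumr_ge0// => i _; exact: sqr_ge0. Qed.

Lemma norm20 : norm2 (0 : 'cV[R]_n) = 0.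
Proof. by rewrite /norm2 big1 ?sqrtr0// => i _; rewrite mxE expr0n. Qed.

Lemma norm2N x : norm2 (- x) = norm2 x.
Proof. by congr Num.sqrt; apply: eq_bigr => i _; rewrite mxE sqrrN. Qed.

Lemma norm2_gt0 x : x != 0 -> 0 < norm2 x.
Proof.
apply: contraNT; rewrite -leNgt => x0.
have /eqP : norm2 x ^+ 2 = 0 by rewrite (@le_anti _ _ (norm2 x) 0) ?expr0n// x0 norm2_ge0.
rewrite sqr_norm2 psumr_eq0 => [|i _]; last exact: sqr_ge0.
move=> /allP x_eq0; apply/eqP/matrixP => i j; rewrite mxE (ord1 j).
by apply/eqP; rewrite -sqrf_eq0; apply: x_eq0; rewrite mem_index_enum.
Qed.
End norm2_theory.

(** * Integrals against Gaussian laws *)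

(** The Radon-Nikodym derivative of [normal_prob m s] agrees almost everywhere with
    [normal_pdf m s], since both have the same integral over every measurable set. *)
Lemma integral_normal_prob (R : realType) (m s : R) (f : R -> \bar R) :
  measurable_fun setT f -> (forall x, 0 <= f x)%E ->
  (\int[normal_prob m s]_x f x =
   \int[lebesgue_measure]_x (f x * (normal_pdf m s x)%:E))%E.
Proof.
move=> mf f0.
have dom := @normal_prob_dominates R m s.
rewrite -(Radon_Nikodym_SigmaFinite.change_of_variables dom f0 measurableT mf).
have mpdf : measurable_fun setT (fun x : R => (normal_pdf m s x)%:E).
  by apply/measurable_EFinP; exact: measurable_normal_pdf.
have mRN := measurable_int _ (Radon_Nikodym_SigmaFinite.f_integrable dom).
apply: ae_eq_integral => //=; [exact: emeasurable_funM..|].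
apply: ae_eqe_mul2l; apply: integral_ae_eq => //.
- exact: Radon_Nikodym_SigmaFinite.f_integrable.
- by move=> E _ mE; rewrite -Radon_Nikodym_SigmaFinite.f_integral.
Qed.

(** Completing the square in [x] turns the integrand times the standard density into a constant
    times another normal density, whose integral is 1. *)
Lemma gaussian_expR_sqr (R : realType) (mu a s : R) :
  0 < 1 - 2 * mu * a ^+ 2 ->
  (\int[normal_prob 0 1]_x (expR (mu * (s + a * x) ^+ 2))%:E =
   ((Num.sqrt (1 - 2 * mu * a ^+ 2))^-1 *
     expR (mu / (1 - 2 * mu * a ^+ 2) * s ^+ 2))%:E)%E.
Proof.
set q := 1 - _ => q0.
have mE : measurable_fun setT (fun x : R => expR (mu * (s + a * x) ^+ 2)).
  apply: measurableT_comp => //; apply: measurable_funM => //.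
  by apply: measurable_funX; apply: measurable_funD => //; exact: measurable_funM.
rewrite integral_normal_prob; last 2 first.
- exact/measurable_EFinP.
- by move=> x; rewrite lee_fin expR_ge0.
have sq0 : 0 < Num.sqrt q by rewrite sqrtr_gt0.
pose K := (Num.sqrt q)^-1 * expR (mu / q * s ^+ 2).
under eq_integral => x _.
  rewrite -EFinM.
  (* The quadratic coefficient of the exponent is [- q / 2], so the new variance is [q^-1]; the
     linear coefficient [2 * mu * s * a] gives the mean. *)
  have -> : expR (mu * (s + a * x) ^+ 2) * normal_pdf 0 1 x =
     K * normal_pdf (2 * mu * s * a / q) (Num.sqrt q)^-1 x.
    rewrite !normal_pdfE ?oner_eq0 ?invr_eq0 ?gt_eqF// /K /normal_peak /normal_fun.
    rewrite exprVn sqr_sqrtr ?ltW// expr1n mul1r.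
    rewrite -(mulrnAr q^-1) sqrtrM ?invr_ge0 ?ltW// sqrtrV ?ltW//.
    rewrite mulrCA -mulrA -expRD [in RHS]invfM invrK.
    have -> : forall A B C : R, (Num.sqrt q)^-1 * (A * (Num.sqrt q * B * C)) = B * (A * C).
      by move=> A B C; field; rewrite gt_eqF.
    rewrite -expRD; congr (_ * expR _).
    by rewrite /q; field; rewrite -/q gt_eqF.
  rewrite EFinM; over.
rewrite ge0_integralZl//=.
- by rewrite integral_normal_pdf mule1.
- by apply/measurable_EFinP; exact: measurable_normal_pdf.
- by move=> x _; rewrite lee_fin normal_pdf_ge0.
- by rewrite lee_fin mulr_ge0 ?invr_ge0 ?sqrtr_ge0 ?expR_ge0.
Qed.

Lemma integral_std_normal_rv {d : measure_display} {T : measurableType d}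
    {R : realType} (P : probability T R) (X : T -> R) (f : R -> \bar R) :
  std_normal_rv P X -> measurable_fun setT f -> (forall x, 0 <= f x)%E ->
  (\int[P]_w f (X w) = \int[normal_prob 0 1]_x f x)%E.
Proof.
move=> [mX XN] mf f0.
pose Xm : {mfun T >-> measurableTypeR R} :=
  HB.pack (X : T -> measurableTypeR R) (isMeasurableFun.Build _ _ T (measurableTypeR R) X mX).
rewrite [RHS](eq_measure_integral (distribution P Xm)); last first.
  by move=> B mB _; apply/esym; exact: XN.
by rewrite ge0_integral_distribution.
Qed.

(** * Joint independence and adjoining one variable at a time *)

Section independence.
Context {dT dU : measure_display} {T : measurableType dT} {R : realType}.
Variables (P : probability T R) (I : finType) (X : I -> T -> R).
Hypothesis mX : forall i, measurable_fun setT (X i).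

(* Joint independence of W and the family of the [X i] with [i \notin J]: the
   constraint [B i = setT] neutralizes the indices in [J]. *)
Definition indep_outside {dU} {U : measurableType dU} (J : {set I}) (W : T -> U)
    : Prop :=
  measurable_fun setT W /\
  forall (B : I -> set R) (C : set U),
    (forall i, measurable (B i)) -> (forall i, i \in J -> B i = setT) ->
    measurable C ->
    P (W @^-1` C `&` \bigcap_(i in [set: I]) (X i @^-1` B i)) =
    (P (W @^-1` C) * \prod_(i : I) P (X i @^-1` B i))%E.

Lemma measurable_rectangle (B : I -> set R) : (forall i, measurable (B i)) ->
  measurable (\bigcap_(i in [set: I]) (X i @^-1` B i)).
Proof.
move=> mB; apply: fin_bigcap_measurable => // i _.
by rewrite -[X in measurable X]setTI; exact: mX.
Qed.

Lemma indep_outside_cst (U : measurableType dU) (u : U) :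
  mutually_independent P X -> indep_outside finset.set0 (fun _ => u).
Proof.
move=> iX; split=> [|B C mB _ _]; first exact: measurable_cst.
rewrite -iX// preimage_cst; case: ifPn => _.
- by rewrite setTI probability_setT mul1e.
- by rewrite set0I measure0 mul0e.
Qed.

Lemma indep_outside_comp {dV} (U : measurableType dU) (V : measurableType dV)
    (f : U -> V) (J : {set I}) (W : T -> U) :
  measurable_fun setT f -> indep_outside J W -> indep_outside J (f \o W).
Proof.
move=> mf [mW iW]; split=> [|B C mB BJ mC]; first exact: measurableT_comp.
rewrite comp_preimage; apply: iW => //.
by rewrite -[X in measurable X]setTI; exact: mf.
Qed.

(** A larger index set leaves fewer rectangles to test. *)
Lemma indep_outsideS (U : measurableType dU) (J K : {set I}) (W : T -> U) :
  J \subset K -> indep_outside J W -> indep_outside K W.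
Proof.
move=> /fintype.subsetP JK [mW iW]; split=> // B C mB BK mC.
by apply: iW => // i /JK; exact: BK.
Qed.

Section adjoin.
Variables (U : measurableType dU) (J : {set I}) (W : T -> U) (k : I).
Hypotheses (iW : indep_outside J W) (kJ : k \notin J).

(** As [k] is outside [J] and [B k] is [setT], the condition on [X k] can be stored in slot [k]; the
    independence of [W] then applies to the modified family [B']. *)
Lemma indep_outside_rectangle (B : I -> set R) (C : set U) (S : set R) :
  (forall i, measurable (B i)) -> (forall i, i \in k |: J -> B i = setT) ->
  measurable C -> measurable S ->
  P ((W @^-1` C `&` X k @^-1` S) `&`
      \bigcap_(i in [set: I]) (X i @^-1` B i)) =
  (P (W @^-1` C) * P (X k @^-1` S) * \prod_(i : I) P (X i @^-1` B i))%E.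
Proof.
move=> mB BkJ mC mS.
pose B' i := if i == k then S else B i.
have -> : W @^-1` C `&` X k @^-1` S `&` \bigcap_(i in [set: I]) (X i @^-1` B i)
    = W @^-1` C `&` \bigcap_(i in [set: I]) (X i @^-1` B' i).
  rewrite -setIA; congr (_ `&` _); apply/seteqP; split=> [w [Sw Bw] i _|w Bw].
    by rewrite /B' /=; case: eqP => [->//|_]; exact: Bw.
  split; first by have := Bw k Logic.I; rewrite /B' eqxx.
  move=> i _; have [->|ik] := eqVneq i k; first by rewrite BkJ ?setU11.
  by have := Bw i Logic.I; rewrite /B' (negbTE ik).
rewrite iW.2//; last 2 first.
- by move=> i; rewrite /B'; case: ifP.
- move=> i iJ; rewrite /B' ifN; first by rewrite BkJ ?setU1r.
  by apply: contraNneq kJ => <-.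
rewrite (bigD1 k)//= [in RHS](bigD1 k)//= {1}/B' eqxx (BkJ k) ?setU11//.
rewrite preimage_setT probability_setT mul1e muleA; congr (_ * _)%E.
by apply: eq_bigr => i /negbTE ik; rewrite /B' ik.
Qed.

Lemma measurable_adjoin : measurable_fun setT (fun w => (W w, X k w)).
Proof. by apply: measurable_fun_pair => //; exact: iW.1. Qed.

(* Both sides, as functions of M, are finite measures that agree on rectangles
   with the product of a scaled law of W and the law of [X k]. *)
Lemma indep_outside_law (B : I -> set R) (M : set (U * R)) :
  (forall i, measurable (B i)) -> (forall i, i \in k |: J -> B i = setT) ->
  measurable M ->
  P ((fun w => (W w, X k w)) @^-1` M `&`
      \bigcap_(i in [set: I]) (X i @^-1` B i)) =
  ((pushforward P W \x pushforward P (X k)) M *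
    \prod_(i : I) P (X i @^-1` B i))%E.
Proof.
move=> mB BkJ mM.
have mF := measurable_rectangle mB.
set F := \bigcap_(i in _) _ in mF *.
pose WX : {mfun T >-> (U * R)%type} :=
  HB.pack (fun w => (W w, X k w)) (isMeasurableFun.Build _ _ _ _ _ measurable_adjoin).
pose Wm : {mfun T >-> U} := HB.pack W (isMeasurableFun.Build _ _ _ _ _ iW.1).
pose Xm : {mfun T >-> R} := HB.pack (X k) (isMeasurableFun.Build _ _ _ _ _ (mX k)).
(* The product of probabilities is finite, so it can serve as the nonnegative real factor of a
   scaled measure. *)
have c0 : 0 <= fine (\prod_(i : I) P (X i @^-1` B i))%E.
  by apply: fine_ge0; apply: prode_ge0.
have cE : (fine (\prod_(i : I) P (X i @^-1` B i)))%:E =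
    (\prod_(i : I) P (X i @^-1` B i))%E.
  rewrite fineK//; apply: prode_fin_num => i _; rewrite fin_num_measure//.
  by rewrite -[X in measurable X]setTI; exact: mX.
pose c := NngNum c0.
(* The law of [(W, X k)] under [P] restricted to [F]. *)
pose mA : {measure set (U * R) -> \bar R} :=
  measure_function_pushforward__canonical__measure_function_Measure
    (mrestr P mF) measurable_adjoin.
pose m1 := mscale c (distribution P Wm).
pose m2 := distribution P Xm.
have mAE : (m1 \x m2)%E M = mA M.
  apply: product_measure_unique => // C S mC mS.
  rewrite /mA /= /pushforward /mrestr.
  rewrite (indep_outside_rectangle mB BkJ mC mS) /m1 /m2 /= /mscale /=.
  by rewrite cE muleC muleA.
transitivity (mA M); first by [].
(* A second use of uniqueness moves the factor [c] out of the product measure. *)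
rewrite -mAE -cE muleC.
apply: (@product_measure_unique _ _ _ _ _ m1 m2
  (mscale c (distribution P Wm \x distribution P Xm)%E)) => // C S mC mS.
by rewrite /m1 /m2 /= /mscale/= product_measure1E// muleA.
Qed.

Lemma indep_pair_law (M : set (U * R)) : measurable M ->
  P ((fun w => (W w, X k w)) @^-1` M) =
  (pushforward P W \x pushforward P (X k))%E M.
Proof.
move=> mM.
have := @indep_outside_law (fun=> setT) M (fun=> measurableT) (fun _ _ => erefl) mM.
rewrite (_ : \bigcap_(i in _) _ = setT); last by apply/seteqP; split.
rewrite setIT big1 ?mule1// => i _.
by rewrite preimage_setT probability_setT.
Qed.

Lemma indep_outside_pair : indep_outside (k |: J) (fun w => (W w, X k w)).
Proof.
split=> [|B C mB BkJ mC]; first exact: measurable_adjoin.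
by rewrite indep_outside_law// indep_pair_law.
Qed.

(** The law of [(W, X k)] is a product, so Tonelli's theorem applies. *)
Lemma integral_indep_pair (h : U * R -> \bar R) :
  measurable_fun setT h -> (forall z, 0 <= h z)%E ->
  (\int[P]_w h (W w, X k w) = \int[P]_w \int[P]_w' h (W w, X k w'))%E.
Proof.
move=> mh h0.
pose WX : {mfun T >-> (U * R)%type} :=
  HB.pack (fun w => (W w, X k w)) (isMeasurableFun.Build _ _ _ _ _ measurable_adjoin).
pose Wm : {mfun T >-> U} := HB.pack W (isMeasurableFun.Build _ _ _ _ _ iW.1).
pose Xm : {mfun T >-> R} := HB.pack (X k) (isMeasurableFun.Build _ _ _ _ _ (mX k)).
rewrite -[LHS](ge0_integral_distribution WX mh h0).
rewrite (eq_measure_integral (distribution P Wm \x distribution P Xm)%E); last first.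
  by move=> M mM _; exact: indep_pair_law.
rewrite fubini_tonelli1//= ge0_integral_distribution//.
- apply: eq_integral => w _; rewrite /= /fubini_F ge0_integral_distribution//.
  exact: measurableT_comp.
- exact: measurable_fun_fubini_tonelli_F.
- by move=> u; apply: integral_ge0.
Qed.
End adjoin.

End independence.

Section measurable_comparison.
Context {d : measure_display} {T : measurableType d} {R : realType}.
Variables f g : T -> R.
Hypotheses (mf : measurable_fun setT f) (mg : measurable_fun setT g).

Lemma measurable_set_ltr : measurable [set w | f w < g w].
Proof.
rewrite -[X in measurable X]setTI.
have := measurable_fun_ltr mf mg => /(_ measurableT [set true]); exact.
Qed.

Lemma measurable_set_ler : measurable [set w | f w <= g w].
Proof.
rewrite -[X in measurable X]setTI.
have := measurable_fun_ler mf mg => /(_ measurableT [set true]); exact.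
Qed.
End measurable_comparison.

(** * The moment generating function of [|A v|^2] and its Chernoff bound *)

Section gaussian_matrix.
Context {dT : measure_display} {T : measurableType dT} {R : realType}.
Variables (P : probability T R) (n d : nat) (A : T -> 'M[R]_(d, n)).
Hypothesis A_normal : forall i j, std_normal_rv P (fun w => A w i j).
Hypothesis A_indep :
  mutually_independent P (fun ij : 'I_d * 'I_n => fun w => A w ij.1 ij.2).
Variable v : 'cV[R]_n.

Local Notation X := (fun ij : 'I_d * 'I_n => fun w => A w ij.1 ij.2).

Let mX ij : measurable_fun setT (X ij). Proof. by case: (A_normal ij.1 ij.2). Qed.

(** In the application [(W w).1] is the contribution of the rows already treated and [(W w).2] the
    partial inner product of the current row. With both frozen, [X k] is integrated out by
    [gaussian_expR_sqr]. *)
Lemma integral_add_gaussian (J : {set 'I_d * 'I_n}) (W : T -> R * R) k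
    (lam mu a : R) :
  indep_outside P X J W -> k \notin J -> 0 < 1 - 2 * mu * a ^+ 2 ->
  (\int[P]_w (expR (lam * (W w).1 + mu * ((W w).2 + a * X k w) ^+ 2))%:E =
   (Num.sqrt (1 - 2 * mu * a ^+ 2))^-1%:E *
   \int[P]_w (expR (lam * (W w).1 +
     mu / (1 - 2 * mu * a ^+ 2) * (W w).2 ^+ 2))%:E)%E.
Proof.
move=> iW kJ q0.
pose h (z : (R * R) * R) : \bar R :=
  (expR (lam * z.1.1 + mu * (z.1.2 + a * z.2) ^+ 2))%:E.
have mh : measurable_fun setT h.
  apply/measurable_EFinP; apply: measurableT_comp => //.
  apply: measurable_funD; apply: measurable_funM => //.
    exact: measurableT_comp.
  apply: measurable_funX; apply: measurable_funD.
    exact: measurableT_comp.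
  exact: measurable_funM.
have h0 z : (0 <= h z)%E by rewrite lee_fin expR_ge0.
rewrite (integral_indep_pair mX iW kJ mh h0).
have mexp mu' : measurable_fun setT (fun w => (expR (lam * (W w).1 + mu' * (W w).2 ^+ 2))%:E).
  apply/measurable_EFinP; apply: measurableT_comp => //.
  have [mW _] := iW.
  apply: measurable_funD; apply: measurable_funM => //.
    exact: measurableT_comp.
  by apply: measurable_funX; exact: measurableT_comp.
rewrite -ge0_integralZl//.
apply: eq_integral => w _; rewrite /h /=.
rewrite (integral_std_normal_rv (A_normal k.1 k.2)
    (f := fun x => (expR (lam * (W w).1 + mu * ((W w).2 + a * x) ^+ 2))%:E)); last 2 first.
- by apply/measurable_EFinP; apply: measurableT_comp => //;
    apply: measurable_funD => //; apply: measurable_funM => //;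
    apply: measurable_funX; apply: measurable_funD => //; exact: measurable_funM.
- by move=> x; rewrite lee_fin expR_ge0.
under eq_integral => x _ do rewrite expRD EFinM.
rewrite ge0_integralZl//=.
  by rewrite gaussian_expR_sqr// -!EFinM expRD mulrCA.
apply/measurable_EFinP; apply: measurableT_comp => //; apply: measurable_funM => //.
by apply: measurable_funX; apply: measurable_funD => //; exact: measurable_funM.
Qed.

Section row.
Variables (J : {set 'I_d * 'I_n}) (Y : T -> R) (i : 'I_d).
Hypotheses (iY : indep_outside P X J Y) (iJ : forall j, (i, j) \notin J).

Let S (s : seq 'I_n) w := \sum_(j <- s) v j ord0 * A w i j.

(** Each entry of row [i] enters only through the running sum, so after it is adjoined a measurable
    map compresses the triple back to a pair. *)
Lemma indep_outside_row (s : seq 'I_n) : uniq s ->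
  indep_outside P X (J :|: [set (i, j) | j in s])%SET (fun w => (Y w, S s w)).
Proof.
elim: s => [|j s IH] /= => [_|/andP[js us]].
  rewrite (_ : (fun w => _) = (fun y => (y, 0)) \o Y); last first.
    by apply/funext => w; rewrite /S big_nil.
  apply: indep_outside_comp; first exact: measurable_fun_pair.
  by apply: indep_outsideS iY; exact: finset.subsetUl.
have ijs : (i, j) \notin (J :|: [set (i, j) | j in s])%SET.
  rewrite !inE negb_or iJ/=; apply/imsetP => -[j' j's [jj']].
  by move: js; rewrite jj' j's.
have := indep_outside_pair mX (IH us) ijs.
move=> /(indep_outside_comp (f := fun z : (R * R) * R => (z.1.1, v j ord0 * z.2 + z.1.2))) H.
rewrite (_ : (fun w => _) = (fun z : (R * R) * R => (z.1.1, v j ord0 * z.2 + z.1.2))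
    \o (fun w => ((Y w, S s w), X (i, j) w))); last first.
  by apply/funext => w; rewrite /S big_cons.
apply: (indep_outsideS _ (H _)).
- apply/fintype.subsetP => -[i' j']; rewrite !inE => /or3P[/eqP[-> ->]|->//|].
  + by apply/orP; right; apply: imset_f; rewrite inE eqxx.
  + move=> /imsetP[j'' j''s ->]; apply/orP; right; apply: imset_f.
    by rewrite inE j''s orbT.
- apply: measurable_fun_pair; first exact: measurableT_comp.
  apply: measurable_funD; first exact: measurable_funM.
  exact: measurableT_comp.
Qed.

(** Induction on [s] with [mu] left general, because integrating out one entry changes it. *)
Lemma integral_expR_row (s : seq 'I_n) (lam mu : R) : uniq s ->
  0 < 1 - 2 * mu * \sum_(j <- s) v j ord0 ^+ 2 ->
  (\int[P]_w (expR (lam * Y w + mu * S s w ^+ 2))%:E =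
   (Num.sqrt (1 - 2 * mu * \sum_(j <- s) v j ord0 ^+ 2))^-1%:E *
   \int[P]_w (expR (lam * Y w))%:E)%E.
Proof.
elim: s mu => [|j s IH] mu /= => [_ _|/andP[js us]].
  rewrite big_nil mulr0 subr0 sqrtr1 invr1 mul1e.
  by apply: eq_integral => w _; rewrite /S big_nil expr0n mulr0 addr0.
rewrite big_cons; set a := v j ord0; set q := \sum_(_ <- _) _ => aq0.
have q0 : 0 <= q by apply: sumr_ge0 => k _; exact: sqr_ge0.
(* Clear for [mu < 0]; for [mu >= 0] it follows from [aq0], since dropping [q >= 0] can only raise
   the value. *)
have a0 : 0 < 1 - 2 * mu * a ^+ 2.
  have := sqr_ge0 a.
  by have [mu0|mu0] := leP 0 mu; nra.
have ijs : (i, j) \notin (J :|: [set (i, j) | j in s])%SET.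
  rewrite !inE negb_or iJ/=; apply/imsetP => -[j' j's [jj']].
  by move: js; rewrite jj' j's.
(* The telescoping identity: the second factor is the quantity for the tail [s] at the updated
   exponent. *)
have E : 1 - 2 * mu * (a ^+ 2 + q) =
   (1 - 2 * mu * a ^+ 2) * (1 - 2 * (mu / (1 - 2 * mu * a ^+ 2)) * q).
  by field; rewrite gt_eqF.
under eq_integral => w _ do rewrite /S big_cons [v j ord0 * _ + _]addrC.
apply: etrans (integral_add_gaussian lam (indep_outside_row us) ijs a0) _.
rewrite /= IH//.
  by rewrite E sqrtrM ?ltW// invfM EFinM muleA.
by move: aq0; rewrite E pmulr_rgt0.
Qed.
End row.

(** The independence claim is carried through the induction because a fresh row is integrated out
    with the sum over the previous rows held fixed. *)
Lemma integral_expR_rows (r : seq 'I_d) (lam : R) : uniq r ->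
  0 < 1 - 2 * lam * \sum_j v j ord0 ^+ 2 ->
  indep_outside P X [set ij | ij.1 \in r]%SET
    (fun w => \sum_(i <- r) (A w *m v) i ord0 ^+ 2) /\
  (\int[P]_w (expR (lam * \sum_(i <- r) (A w *m v) i ord0 ^+ 2))%:E =
   ((Num.sqrt (1 - 2 * lam * \sum_j v j ord0 ^+ 2))^-1 ^+ size r)%:E)%E.
Proof.
move=> + lam0; elim: r => [|i r IH] /= => [_|/andP[ir ur]].
  split.
    rewrite (_ : (fun w => \sum_(i <- [::]) _) = fun=> 0); last first.
      by apply/funext => w; rewrite big_nil.
    by apply: (indep_outsideS _ (indep_outside_cst _ A_indep)); exact: finset.sub0set.
  under eq_integral do rewrite big_nil mulr0 expR0.
  by rewrite integral_cst// mul1e; exact: probability_setT.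
have {}IH := IH ur; case: IH => iQ EQ.
have iJ j : (i, j) \notin [set ij : 'I_d * 'I_n | ij.1 \in r]%SET by rewrite inE.
have un : uniq (index_enum 'I_n) by exact: index_enum_uniq.
have AE w : (A w *m v) i ord0 = \sum_j v j ord0 * A w i j.
  by rewrite mxE; apply: eq_bigr => j _; rewrite mulrC.
split.
  have := indep_outside_row iQ iJ un.
  move=> /(indep_outside_comp (f := fun z : R * R => z.2 ^+ 2 + z.1)) H.
  rewrite (_ : (fun w => _) = (fun z : R * R => z.2 ^+ 2 + z.1)
      \o (fun w => (\sum_(i <- r) (A w *m v) i ord0 ^+ 2,
                    \sum_j v j ord0 * A w i j))); last first.
    by apply/funext => w; rewrite big_cons AE.
  apply: (indep_outsideS _ (H _)).
    apply/fintype.subsetP => -[i' j']; rewrite !inE /= => /orP[->|]; first by rewrite orbT.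
    by move=> /imsetP[j'' _ [-> _]]; rewrite eqxx.
  by apply: measurable_funD => //; apply: measurable_funX.
under eq_integral => w _ do rewrite big_cons AE addrC mulrDr.
by rewrite (integral_expR_row iQ iJ lam un lam0) EQ exprS EFinM.
Qed.

Lemma measurable_sqr_norm_mulmx :
  measurable_fun setT (fun w => norm2 (A w *m v) ^+ 2).
Proof.
under eq_fun do rewrite sqr_norm2.
apply: measurable_sum => i; apply: measurable_funX.
under eq_fun do rewrite mxE.
by apply: measurable_sum => j; apply: measurable_funM => //; exact: (mX (i, j)).
Qed.

Lemma integral_expR_sqr_norm (lam : R) : 0 < 1 - 2 * lam * norm2 v ^+ 2 ->
  (\int[P]_w (expR (lam * norm2 (A w *m v) ^+ 2))%:E =
   ((Num.sqrt (1 - 2 * lam * norm2 v ^+ 2))^-1 ^+ d)%:E)%E.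
Proof.
rewrite sqr_norm2 => lam0.
under eq_integral do rewrite sqr_norm2.
have [_ ->] := integral_expR_rows (index_enum_uniq 'I_d) lam0.
by have := size_enum_ord d; rewrite enumT => ->.
Qed.

(* Chernoff's bound with the optimal exponent [lam = tau / (2 (1 + tau))] for
   a unit vector; [tau > 0] gives the upper tail, [tau < 0] the lower one. *)
Lemma sqr_norm_mulmx_tail (tau : R) : -1 < tau -> v != 0 ->
  (P [set w | tau * (d%:R * (1 + tau) * norm2 v ^+ 2) <=
              tau * norm2 (A w *m v) ^+ 2]%R <=
   (expR (- (d%:R / 2 * (tau - ln (1 + tau)))))%:E)%E.
Proof.
move=> tau1 v0.
have t0 : 0 < 1 + tau by rewrite -ltrBlDl sub0r.
have nv0 : 0 < norm2 v ^+ 2 by rewrite exprn_gt0// norm2_gt0.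
have mY : measurable_fun setT (fun w => tau * norm2 (A w *m v) ^+ 2).
  by apply: measurable_funM => //; exact: measurable_sqr_norm_mulmx.
pose Y : {mfun T >-> R} := HB.pack (fun w => tau * norm2 (A w *m v) ^+ 2)
  (isMeasurableFun.Build _ _ _ _ _ mY).
(* The sign of [tau] is put into [Y], so that the parameter [r] given to [chernoff] is positive for
   both tails. *)
pose r := (2 * (1 + tau) * norm2 v ^+ 2)^-1.
have r0 : 0 < r by rewrite invr_gt0 mulr_gt0// mulr_gt0.
apply: (le_trans (chernoff Y (tau * (d%:R * (1 + tau) * norm2 v ^+ 2)) r0)).
have lamE : 1 - 2 * (r * tau) * norm2 v ^+ 2 = (1 + tau)^-1.
  by rewrite /r; field; rewrite (gt_eqF t0) (gt_eqF (norm2_gt0 v0)).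
rewrite /mmt_gen_fun unlock.
under eq_integral => w _.
  rewrite /= mulrC mulrA.
  over.
rewrite integral_expR_sqr_norm ?lamE ?invr_gt0//.
rewrite -EFinM lee_fin sqrtrV ?(ltW t0)// invrK.
have -> : Num.sqrt (1 + tau) = expR (ln (1 + tau) / 2).
  rewrite -[X in Num.sqrt X]lnK ?posrE// -[X in expR X](@divfK _ 2)//.
  by rewrite mulr2n mulrDr mulr1 expRD -expr2 sqrtr_sqr ger0_norm ?expR_ge0.
rewrite -expRM_natl -expRD ler_expR.
rewrite le_eqVlt; apply/orP; left; apply/eqP.
by rewrite /r; field; rewrite (gt_eqF t0) (gt_eqF (norm2_gt0 v0)).
Qed.

End gaussian_matrix.

(** * The two bad events for a fixed vector *)

Section gaussian_matrix_tails.
Context {dT : measure_display} {T : measurableType dT} {R : realType}.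
Variables (P : probability T R) (n d : nat) (A : T -> 'M[R]_(d, n)).
Hypothesis A_normal : forall i j, std_normal_rv P (fun w => A w i j).
Hypothesis A_indep :
  mutually_independent P (fun ij : 'I_d * 'I_n => fun w => A w ij.1 ij.2).

(** The inequality is strict, here and in [shrunk], so that the event is empty at [v = 0] and its
    complement is the non-strict bound wanted later. *)
Definition stretched (tau : R) (v : 'cV[R]_n) : set T :=
  [set w | d%:R * (1 + tau) * norm2 v ^+ 2 < norm2 (A w *m v) ^+ 2].

Definition shrunk (tau : R) (v : 'cV[R]_n) : set T :=
  [set w | norm2 (A w *m v) ^+ 2 < d%:R * (1 - tau) * norm2 v ^+ 2].

Lemma measurable_stretched tau v : measurable (stretched tau v).
Proof.
by apply: measurable_set_ltr => //; exact: measurable_sqr_norm_mulmx.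
Qed.

Lemma measurable_shrunk tau v : measurable (shrunk tau v).
Proof.
by apply: measurable_set_ltr => //; exact: measurable_sqr_norm_mulmx.
Qed.

Lemma stretched_tail (tau : R) (v : 'cV[R]_n) : 0 < tau ->
  (P (stretched tau v) <= (expR (- (d%:R / 2 * (tau - ln (1 + tau)))))%:E)%E.
Proof.
move=> tau0; have [->|v0] := eqVneq v 0.
  rewrite (_ : stretched _ _ = set0) ?measure0 ?lee_fin ?expR_ge0//.
  by apply/seteqP; split=> // w; rewrite /stretched /= mulmx0 !norm20 expr0n/= mulr0 ltxx.
have tau1 : -1 < tau by rewrite (lt_trans _ tau0)// ltrN10.
apply: le_trans (sqr_norm_mulmx_tail A_normal A_indep tau1 v0).
apply: le_measure; rewrite ?inE//.
- exact: measurable_stretched.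
- apply: measurable_set_ler => //; apply: measurable_funM => //.
  exact: measurable_sqr_norm_mulmx.
- by move=> w /ltW; rewrite /= ler_pM2l.
Qed.

Lemma shrunk_tail (tau : R) (v : 'cV[R]_n) : 0 < tau < 1 ->
  (P (shrunk tau v) <= (expR (d%:R / 2 * (tau + ln (1 - tau))))%:E)%E.
Proof.
move=> /andP[tau0 tau1]; have [->|v0] := eqVneq v 0.
  rewrite (_ : shrunk _ _ = set0) ?measure0 ?lee_fin ?expR_ge0//.
  by apply/seteqP; split=> // w; rewrite /shrunk /= mulmx0 !norm20 expr0n/= mulr0 ltxx.
(* The general tail at [- tau]: multiplying by a negative number turns an upper tail into a lower
   one. *)
have tauN : -1 < - tau by rewrite ltrN2.
have := sqr_norm_mulmx_tail A_normal A_indep tauN v0.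
rewrite (_ : - (_ * _) = d%:R / 2 * (tau + ln (1 - tau))); last by ring.
apply: le_trans.
apply: le_measure; rewrite ?inE//.
- exact: measurable_shrunk.
- apply: measurable_set_ler => //; apply: measurable_funM => //.
  exact: measurable_sqr_norm_mulmx.
- by move=> w /ltW; rewrite /= ler_nM2l// oppr_lt0.
Qed.

End gaussian_matrix_tails.

(** * Union bound, distortion and the deterministic error estimate *)

Lemma probability_bigsetU_le {dT : measure_display} {T : measurableType dT}
    {R : realType} (P : probability T R) (I : Type) (s : seq I) (F : I -> set T) :
  (forall i, measurable (F i)) ->
  (P (\big[setU/set0]_(i <- s) F i) <= \sum_(i <- s) P (F i))%E.
Proof.
move=> mF; elim: s => [|i s IH]; first by rewrite !big_nil measure0.
rewrite !big_cons (le_trans (measureU2 _ _ _))//; last exact: leeD2l.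
exact: bigsetU_measurable.
Qed.

(** A [sup] is known to dominate its set only when that set is bounded above. Boundedness comes from
    compactness of [Q], coordinate by coordinate, and from the finiteness of the decoder's range. *)
Lemma distortion_ub {R : realType} {n r : nat} (Q : set 'cV[R]_n)
    (E : 'cV[R]_n -> 'I_(2 ^ r)) (D : 'I_(2 ^ r) -> 'cV[R]_n) (x : 'cV[R]_n) :
  compact Q -> Q x -> norm2 (x - D (E x)) <= distortion Q E D.
Proof.
move=> cQ Qx; apply: ub_le_sup; last by exists x.
have /choice[M QM] (i : 'I_n) : exists M, forall y, Q y -> `|y i ord0| <= M.
  have /compact_bounded[M [_ /(_ (M + 1))]] :
      compact ((fun y : 'cV[R]_n => y i ord0 : R^o) @` Q).
    apply: continuous_compact => //.
    by apply: continuous_subspaceT => y; exact: coord_continuous.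
  (* Boundedness is phrased for every number strictly above [M], hence [M + 1]. *)
  by rewrite ltrDl ltr01 => /(_ isT) H; exists (M + 1) => y Qy; apply: H; exists y.
(* Summing over all codewords gives a bound independent of [E y]. *)
exists (Num.sqrt (\sum_i (M i + \sum_k `|D k i ord0|) ^+ 2)) => _ [y Qy <-].
apply: ler_wsqrtr; apply: ler_sum => i _; rewrite !mxE.
rewrite -[leLHS]real_normK ?num_real//.
have yD : `|y i ord0 - D (E y) i ord0| <= M i + \sum_k `|D k i ord0|.
  apply: le_trans (ler_normB _ _) _; apply: lerD; first exact: QM.
  by rewrite (bigD1 (E y))//= lerDl sumr_ge0.
by apply: lerXn2r => //; rewrite nnegrE// (le_trans _ yD).
Qed.

(** The deterministic half, for one matrix off the bad events. The lower bound is asked for every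
    index because the minimizer may be any codeword, whereas the upper one concerns only the
    codeword of [xo]. *)
Lemma csp_error_bound {R : realType} {n d r : nat} (Q : set 'cV[R]_n)
    (E : 'cV[R]_n -> 'I_(2 ^ r)) (D : 'I_(2 ^ r) -> 'cV[R]_n)
    (A : 'M[R]_(d, n)) (xo xhat : 'cV[R]_n) (tau1 tau2 : R) :
  compact Q -> Q xo -> 0 < tau1 -> 0 < tau2 < 1 -> (0 < d)%N ->
  norm2 (A *m (xo - D (E xo))) ^+ 2 <=
    d%:R * (1 + tau1) * norm2 (xo - D (E xo)) ^+ 2 ->
  (forall k, d%:R * (1 - tau2) * norm2 (xo - D k) ^+ 2 <=
    norm2 (A *m (xo - D k)) ^+ 2) ->
  csp_minimizer (codebook Q E D) A (A *m xo) xhat ->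
  norm2 (xhat - xo) <= distortion Q E D * Num.sqrt ((1 + tau1) / (1 - tau2)).
Proof.
move=> cQ Qxo tau10 /andP[tau20 tau21] d0 upper lower [[x Qx <-] xmin].
have {xmin} := xmin (D (E xo)) (ex_intro2 _ _ xo Qxo erefl).
rewrite -!mulmxBr => xmin.
have t2 : 0 < 1 - tau2 by rewrite subr_gt0.
have dR : 0 < d%:R :> R by rewrite ltr0n.
have xo_xhat : (1 - tau2) * norm2 (xo - D (E x)) ^+ 2 <=
    (1 + tau1) * norm2 (xo - D (E xo)) ^+ 2.
  rewrite -(ler_pM2l dR) mulrA [leRHS]mulrA.
  exact: le_trans (lower (E x)) (le_trans xmin upper).
rewrite -norm2N opprB.
apply: (@le_trans _ _ (norm2 (xo - D (E xo)) * Num.sqrt ((1 + tau1) / (1 - tau2)))).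
  have q0 : 0 <= (1 + tau1) / (1 - tau2).
    by rewrite divr_ge0 ?ltW// addr_gt0.
  rewrite -(@ler_pXn2r _ 2) ?nnegrE ?mulr_ge0 ?norm2_ge0 ?sqrtr_ge0//.
  rewrite exprMn (sqr_sqrtr q0) mulrA ler_pdivlMr// mulrC.
  by rewrite [leRHS]mulrC.
by rewrite ler_wpM2r ?sqrtr_ge0//; exact: distortion_ub.
Qed.

(** * Assembly of the probability bound *)

Unset Implicit Arguments.

(** The minimizer need not be unique or chosen measurably in [w], so the probability is that of a
    measurable event [G] on which every minimizer obeys the bound. *)
Theorem theorem1 (R : realType) (n d r : nat) (Q : set 'cV[R]_n)
  (E : 'cV[R]_n -> 'I_(2 ^ r)) (D : 'I_(2 ^ r) -> 'cV[R]_n)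
  (dT : measure_display) (T : measurableType dT) (P : probability T R)
  (A : T -> 'M[R]_(d, n)) (xo : 'cV[R]_n) (tau1 tau2 : R) :
  compact Q ->
  (forall i j, std_normal_rv P (fun w => A w i j)) ->
  mutually_independent P (fun ij : 'I_d * 'I_n => fun w => A w ij.1 ij.2) ->
  Q xo -> 0 < tau1 -> 0 < tau2 < 1 ->
  exists G : set T, measurable G /\
    (forall w, G w -> forall xhat,
        csp_minimizer (codebook Q E D) (A w) (A w *m xo) xhat ->
        norm2 (xhat - xo) <=
          distortion Q E D * Num.sqrt ((1 + tau1) / (1 - tau2))) /\
    ((1 - (2 ^+ r)%:R * expR (d%:R / 2 * (tau2 + ln (1 - tau2)))
         - expR (- (d%:R / 2 * (tau1 - ln (1 + tau1)))))%:E <= P G)%E.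
Proof.
move=> cQ A_normal A_indep Qxo tau10 tau20.
have [d0|d_gt0] := posnP d.
  (* the claimed lower bound is [- 2 ^ r] *)
  exists set0; split=> //; split=> //.
  rewrite measure0 lee_fin d0 mul0r !mul0r oppr0 expR0 mulr1 addrAC subrr sub0r.
  by rewrite oppr_le0 ler0n.
pose up := stretched A tau1 (xo - D (E xo)).
(* One event per index, whether or not the encoder attains it; this gives the [2 ^ r] terms of the
   union bound. *)
pose lo k := shrunk A tau2 (xo - D k).
have m_up : measurable up by exact: measurable_stretched.
have m_lo k : measurable (lo k) by exact: measurable_shrunk.
have m_los : measurable (\big[setU/set0]_k lo k) by exact: bigsetU_measurable.
pose bad := up `|` \big[setU/set0]_k lo k.
have m_bad : measurable bad by exact: measurableU.
exists (~` bad); split; first exact: measurableC.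
split=> [w /not_orP[notup notlo] xhat|].
  apply: csp_error_bound => //.
  - by rewrite leNgt; apply/negP.
  - move=> k; rewrite leNgt; apply/negP => lok; apply: notlo.
    by rewrite -bigcup_seq; exists k => //=; rewrite mem_index_enum.
rewrite probability_setC// -addrA -opprD EFinB leeB//.
apply: (le_trans (measureU2 _ m_up m_los)).
rewrite EFinD [leRHS]addeC; apply: leeD; first exact: stretched_tail.
apply: le_trans (probability_bigsetU_le _ _ m_lo) _.
apply: le_trans (lee_sum _ (fun k _ => shrunk_tail A_normal A_indep _ tau20)) _.
by rewrite sumEFin lee_fin sumr_const card_ord [leRHS]mulr_natl -natrXE.
Qed.
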